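(* For every $n\in\mathbb{N}$, the polynomial $(-q;q)_n=\prod_{0<k\le n}(1+q^k)$ divides the numerator of $C_{2n}(q)$.
   Context: For $n\in\mathbb{N}$, $(a;q)_n=\prod_{0\le k<n}(1-aq^k)$ (with $(a;q)_0=1$) and $[n]_q=(1-q^n)/(1-q)$. The $q$-Carlitz numbers $C_n(q)$ ($n\in\mathbb{N}$) are defined by the formal power series identity $$\sum_{n=0}^{\infty}C_n(q)\frac{x^n}{(q;q)_n}=\sum_{n=0}^{\infty}\frac{q^{n(n-1)}x^{2n+1}}{(q;q)_{2n+1}}\Big/\sum_{n=0}^{\infty}\frac{(-1)^nq^{n(2n+1)}x^{2n+1}}{(q;q)_{2n+1}}.$$ Each $C_{2n}(q)$ is a rational function of $q$ with $[1]_q[3]_q\cdots[2n+1]_q\,C_{2n}(q)\in\mathbb{Z}[q]$; its numerator means the numerator $P$ when $C_{2n}(q)$ is written as $P/Q$ with $P,Q\in\mathbb{Z}[q]$ coprime, and divisibility is in $\mathbb{Z}[q]$. *)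

(* Defs.v *)
From HB Require Import structures.
From mathcomp Require Import all_boot all_order all_algebra.
From Stdlib Require Import Classical.
From mathcomp Require Import zify.
Set Implicit Arguments.
Unset Strict Implicit.
Unset Printing Implicit Defensive.
Import Order.TTheory GRing.Theory Num.Theory.
Local Open Scope ring_scope.

Notation Zq := {poly int}.
Notation Qq := {fraction {poly int}}.

Definition qvar : Qq := FracField.tofrac ('X : Zq).

Definition qpoch (R : nzRingType) (a q : R) (n : nat) : R :=
  \prod_(0 <= k < n) (1 - a * q ^+ k).

Lemma qpochNXE (n : nat) :
  qpoch (- 'X : Zq) 'X n = \prod_(1 <= k < n.+1) (1 + 'X^k).
Proof.
rewrite big_add1 /qpoch; apply: eq_bigr => k _.
by rewrite mulNr opprK -exprS.
Qed.

(* A formal power series over R is its sequence of coefficients nat -> R. *)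
Definition fps_mul (R : nzRingType) (f g : nat -> R) : nat -> R :=
  fun m => \sum_(i < m.+1) f i * g (m - i)%N.

(* With m = 2n+1, i.e. n = m./2, the coefficient of x^m on the right-hand
   side of each series below is the one indexed by n. *)
Definition carlitz_num : nat -> Qq := fun m =>
  if odd m then qvar ^+ (m./2 * (m./2 - 1)) / qpoch qvar qvar m else 0.

Definition carlitz_den : nat -> Qq := fun m =>
  if odd m then (-1) ^+ m./2 * qvar ^+ (m./2 * (2 * m./2 + 1)) / qpoch qvar qvar m
  else 0.

Definition carlitz_gf (C : nat -> Qq) : nat -> Qq := fun n =>
  C n / qpoch qvar qvar n.

(* The quotient of carlitz_num by carlitz_den exists although carlitz_den has
   zero constant term; it is characterised by multiplying out
   (see is_qCarlitz_exists and is_qCarlitz_unique). *)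
Definition is_qCarlitz (C : nat -> Qq) : Prop :=
  fps_mul (carlitz_gf C) carlitz_den =1 carlitz_num.

(* Divisibility in the ring itself; polydiv's %| on {poly int} is only
   divisibility up to a nonzero integer factor. *)
Definition divides (R : comNzRingType) (a b : R) : Prop := exists c, b = c * a.

Definition coprime_elts (R : comUnitRingType) (a b : R) : Prop :=
  forall d : R, divides d a -> divides d b -> d \is a GRing.unit.

(* The numerator is determined up to sign. *)
Definition is_numerator (P : Zq) (f : Qq) : Prop :=
  exists Q : Zq,
    [/\ Q != 0, coprime_elts P Q & f = FracField.tofrac P / FracField.tofrac Q].

Lemma fps_mulS (R : nzRingType) (h g : nat -> R) (m : nat) : g 0 = 0 ->
  fps_mul h g m.+1 = \sum_(i < m) h i * g (m.+1 - i)%N + h m * g 1.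
Proof.
move=> g0; rewrite /fps_mul 2!big_ord_recr /= subnn g0 mulr0 addr0.
by rewrite subSnn.
Qed.

Lemma fps_quot_exists (F : fieldType) (f g : nat -> F) :
  f 0 = 0 -> g 0 = 0 -> g 1 != 0 -> exists h, fps_mul h g =1 f.
Proof.
move=> f0 g0 g1.
pose s := fix s m := if m is m'.+1 then
  rcons (s m') ((f m - \sum_(i < m') (s m')`_i * g (m - i)%N) / g 1)
  else [::].
have szs m : size (s m) = m by elim: m => //= m IH; rewrite size_rcons IH.
have sE m i : (i < m)%N -> (s m)`_i = (s i.+1)`_i.
  elim: m => // m IH; rewrite ltnS leq_eqVlt => /orP[/eqP-> //|lim].
  by rewrite -IH //= nth_rcons szs lim.
exists (fun i => (s i.+1)`_i) => -[|m].
  by rewrite /fps_mul big_ord1 g0 mulr0 f0.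
rewrite fps_mulS // [s m.+1]/= nth_rcons szs ltnn eqxx.
rewrite divfK // addrC -[RHS](subrK (\sum_(i < m) (s m)`_i * g (m.+1 - i)%N)).
by congr (_ + _); apply: eq_bigr => i _; rewrite (sE m).
Qed.

Lemma fps_quot_unique (F : fieldType) (g h h' : nat -> F) :
  g 0 = 0 -> g 1 != 0 -> fps_mul h g =1 fps_mul h' g -> h =1 h'.
Proof.
move=> g0 g1 hh' n; elim/ltn_ind: n => m IH.
have := hh' m.+1; rewrite !fps_mulS //.
rewrite (eq_bigr (fun i : 'I_m => h' i * g (m.+1 - i)%N)); last first.
  by move=> i _; rewrite IH.
by move/addrI/(mulIf g1).
Qed.

Lemma qpoch_qvar_neq0 (n : nat) : qpoch qvar qvar n != 0.
Proof.
rewrite /qpoch prodf_seq_neq0; apply/allP => k _ /=.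
rewrite -exprS /qvar -(rmorphXn (@FracField.tofrac Zq)).
rewrite -(rmorph1 (@FracField.tofrac Zq)) -rmorphB tofrac_eq0.
apply/negP => /eqP/(congr1 (fun p : Zq => p.[0])).
by rewrite !hornerE expr0n subr0 => /eqP; rewrite oner_eq0.
Qed.

Lemma carlitz_den1_neq0 : carlitz_den 1 != 0.
Proof.
rewrite /carlitz_den /= mul0n !expr0 !mul1r.
by rewrite invr_eq0 qpoch_qvar_neq0.
Qed.

Lemma is_qCarlitz_exists : exists C, is_qCarlitz C.
Proof.
have [//|//|h hP] := @fps_quot_exists _ carlitz_num carlitz_den _ _ carlitz_den1_neq0.
exists (fun n => h n * qpoch qvar qvar n) => m; rewrite -hP.
by apply: eq_bigr => i _; rewrite /carlitz_gf mulfK ?qpoch_qvar_neq0.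
Qed.

Lemma is_qCarlitz_unique (C C' : nat -> Qq) :
  is_qCarlitz C -> is_qCarlitz C' -> C =1 C'.
Proof.
move=> CP C'P n.
have /(_ n) : carlitz_gf C =1 carlitz_gf C'.
  apply: (@fps_quot_unique _ carlitz_den _ _ _ carlitz_den1_neq0) => // m.
  by rewrite CP C'P.
by move/(mulIf (invr_neq0 (qpoch_qvar_neq0 n))).
Qed.

Lemma fraction_repr (R : idomainType) (f : {fraction R}) : exists P Q : R,
  Q != 0 /\ f = FracField.tofrac P / FracField.tofrac Q.
Proof.
elim/quotW: f => x; exists \n_x, \d_x; have dn0 := denom_ratioP x.
split=> //; apply: (canRL (mulfK _)); first by rewrite tofrac_eq0.
unlock FracField.tofrac.
transitivity (\pi_({fraction R}) (FracField.mulf x (Ratio \d_x 1)))%qT.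
  by rewrite -[LHS]FracField.pi_mul.
apply/eqmodP => /=; rewrite /FracField.equivf /FracField.mulf.
rewrite !numden_Ratio ?oner_eq0 ?mulr1 //.
by rewrite mulrC.
Qed.

Lemma is_numerator_exists (f : Qq) : exists P, is_numerator P f.
Proof.
have [P0 [Q0 [Q0n0 fE0]]] := fraction_repr f.
pose mu (Q : Zq) := (size Q + `|lead_coef Q|)%N.
have [k] := ubnP (mu Q0).
elim: k => // k IH in P0 Q0 Q0n0 fE0 * => muQ.
have [[P [Q [Qn0 fE ltQ]]]|noQ] := classic (exists P Q : Zq,
    [/\ Q != 0, f = FracField.tofrac P / FracField.tofrac Q & (mu Q < mu Q0)%N]).
  by apply: (IH P Q Qn0 fE); apply: leq_trans ltQ _.
exists P0, Q0; split=> // d [P PE] [Q QE].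
have /andP[Qn0 dn0] : (Q != 0) && (d != 0) by rewrite -negb_or -mulf_eq0 -QE.
have fE : f = FracField.tofrac P / FracField.tofrac Q.
  by rewrite fE0 PE QE !tofracM -mulf_div divff ?mulr1 // tofrac_eq0.
have {noQ} : (mu Q0 <= mu Q)%N.
  by rewrite leqNgt; apply/negP => ltQ; apply: noQ; exists P, Q.
rewrite QE /mu size_mul // lead_coefM abszM => le_mu.
have lQ : (0 < `|lead_coef Q|)%N by rewrite absz_gt0 lead_coef_eq0.
have ld : (0 < `|lead_coef d|)%N by rewrite absz_gt0 lead_coef_eq0.
have sd : (0 < size d)%N by rewrite size_poly_gt0.
have lM := leq_pmulr `|lead_coef Q| ld.
have sQ : (0 < size Q)%N by rewrite size_poly_gt0.
have sz1 : size d = 1%N.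
  move: le_mu lM sd sQ {lQ ld}; move: (_ * _)%N => a; set x := size d; set y := size Q; set z := absz _; clearbody x y z; lia.
have l1 : `|lead_coef d|%N = 1%N.
  apply/eqP; rewrite eqn_leq ld andbT -(leq_pmul2l lQ) muln1.
  by move: le_mu; rewrite sz1 addn1 /= leq_add2l.
have := l1; rewrite poly_unitE lead_coefE sz1 eqxx /= => l1'.
by case: (d`_0) l1' => [[|[|]]|[|]].
Qed.

(* Main.v *)
(** Multiply numerator and denominator of the generating function by
    [G(x) = sum_n (-1)^n x^(2n) / (q;q)_(2n)].  By Gauss's q-binomial theorem the
    denominator becomes [sum_n (-1)^n (-q;q)_(2n) x^(2n+1) / (q;q)_(2n+1)].  Call
    a rational function of [q] even-integral if its denominator is coprime to all
    [1 + q^k]; for instance [1 / (1 - q^i)] with [i] odd.  The series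
    [sum_n f_n x^(2n)] for which all [f_n (q;q)_n] are even-integral are closed
    under multiplication, since the q-binomial coefficients are polynomials, and
    since [(q;q)_(2n) = (q;q^2)_n (q;q)_n (-q;q)_n], the claim says that
    [sum_n C_(2n) x^(2n) / (q;q)_(2n)] is one of them.  It thus suffices to treat the
    two products with [G] (divided by [x]), the denominator having in addition an
    invertible constant term [1 / (1 - q)].  For the denominator this is immediate.
    For the numerator, expanding the factors [(q;q^2)] by the q-Vandermonde
    identity in base [q^2] leaves inner sums that Gauss's theorem evaluates as
    multiples of [(q^2;q^2)_(n-2j)]; the remaining quotients
    [(q;q)_n / (q^2;q^2)_j] with [2j <= n] are polynomials because [(q^2;q^2)_j]
    divides [(q;q)_(2j)]. *)

Require Import Defs.
From mathcomp Require Import all_boot all_order all_algebra.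
From mathcomp Require Import zify ring.
Set Implicit Arguments.
Unset Strict Implicit.
Unset Printing Implicit Defensive.
Import GRing.Theory.
Local Open Scope ring_scope.

(** * Splitting rules for q-Pochhammer products *)

Lemma qpochS (R : nzRingType) (a q : R) n :
  qpoch a q n.+1 = qpoch a q n * (1 - a * q ^+ n).
Proof. by rewrite /qpoch big_nat_recr. Qed.

Lemma qpoch0 (R : nzRingType) (a q : R) : qpoch a q 0 = 1.
Proof. by rewrite /qpoch big_geq. Qed.

Lemma qpoch_add (R : nzRingType) (a q : R) m n :
  qpoch a q (m + n) = qpoch a q m * qpoch (a * q ^+ m) q n.
Proof.
elim: n => [|n IH]; first by rewrite addn0 qpoch0 mulr1.
by rewrite addnS !qpochS IH mulrA exprD mulrA.
Qed.

Lemma qpoch_recl (R : nzRingType) (a q : R) n :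
  qpoch a q n.+1 = (1 - a) * qpoch (a * q) q n.
Proof. by rewrite -add1n qpoch_add qpochS qpoch0 mul1r expr0 mulr1 expr1. Qed.

Lemma qpoch_double (R : comNzRingType) (a q : R) n :
  qpoch a q n.*2 = qpoch a (q ^+ 2) n * qpoch (a * q) (q ^+ 2) n.
Proof.
elim: n => [|n IH]; first by rewrite !qpoch0 mulr1.
rewrite doubleS !qpochS IH -exprM mul2n -[a * q * _]mulrA -exprS.
by rewrite -!mulrA; congr (_ * _); rewrite [RHS]mulrCA.
Qed.

Lemma qpoch_square (R : comNzRingType) (a q : R) n :
  qpoch (a ^+ 2) (q ^+ 2) n = qpoch a q n * qpoch (- a) q n.
Proof.
rewrite /qpoch -big_split; apply: eq_bigr => k _ /=.
by rewrite -exprM mulnC exprM; ring.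
Qed.

(** * Gaussian binomials, Gauss's theorem and the q-Vandermonde identity *)

(** Gaussian binomials by a Pascal rule instead of a quotient, so that they are visibly polynomials
    in [q]. The truncated [n' - k'] is harmless: its cofactor is zero for [n' < k']. *)
Fixpoint qbin (R : comNzRingType) (q : R) (n k : nat) : R :=
  match n, k with
  | _, 0 => 1
  | 0, _.+1 => 0
  | n'.+1, k'.+1 => qbin q n' k'.+1 + q ^+ (n' - k') * qbin q n' k'
  end.

Lemma qbin0 (R : comNzRingType) (q : R) n : qbin q n 0 = 1.
Proof. by case: n. Qed.

Lemma qbin_small (R : comNzRingType) (q : R) n k : (n < k)%N -> qbin q n k = 0.
Proof.
elim: n k => [|n IH] [|k] //= nk.
by rewrite !IH ?mulr0 ?addr0 // (leq_trans _ nk).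
Qed.

Lemma qbin_fact (R : comNzRingType) (q : R) n k : (k <= n)%N ->
  qbin q n k * qpoch q q k * qpoch q q (n - k) = qpoch q q n.
Proof.
elim: n k => [|n IH] [|k] //=; rewrite ?qpoch0 ?subn0 ?mulr1 ?mul1r //.
rewrite ltnS subSS => kn.
rewrite 2!qpochS -(IH k kn) !mulrDl.
have [->|ltkn] := eqVneq k n.
  by rewrite qbin_small // subnn expr0 qpoch0; ring.
have {}ltkn : (k < n)%N by rewrite ltn_neqAle ltkn.
have -> : qbin q n k.+1 * (qpoch q q k * (1 - q * q ^+ k)) * qpoch q q (n - k)
   = qpoch q q n * (1 - q ^+ (n - k)).
  by rewrite -(IH _ ltkn) qpochS -(subnSK ltkn) qpochS exprS; ring.
have -> : q ^+ n = q ^+ (n - k) * q ^+ k by rewrite -exprD subnK.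
by rewrite -(IH k kn); ring.
Qed.

(** Peeling off the last factor [y + q^n x] matches the defining Pascal rule, as
    [q^(n-k) q^k = q^n]. The form is homogeneous because [y] will be [1], [-1] and minus the
    base. *)
Lemma gauss_qbin (R : comNzRingType) (q x y : R) n :
  \sum_(k < n.+1) qbin q n k * q ^+ 'C(k, 2) * x ^+ k * y ^+ (n - k) =
  \prod_(0 <= i < n) (y + q ^+ i * x).
Proof.
elim: n => [|n IH].
  by rewrite big_ord1 big_geq // qbin0 !expr0 !mulr1.
rewrite big_nat_recr //= -IH big_ord_recl /= bin0n expr0 !mul1r subn0.
rewrite [in RHS]mulrDr !mulr_suml.
under eq_bigr => k _ do rewrite /= /bump /= add1n subSS !mulrDl.
rewrite big_split /= addrA; congr (_ + _); last first.
  apply: eq_bigr => -[k /= kn] _; rewrite add0n binS bin1 exprD exprS.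
  have -> : q ^+ n = q ^+ (n - k) * q ^+ k by rewrite -exprD subnK.
  ring.
rewrite [RHS]big_ord_recl qbin0 expr0 !mul1r subn0 -exprSr.
congr (_ + _); rewrite big_ord_recr /= qbin_small // !mul0r addr0.
apply: eq_bigr => k _; rewrite /= /bump /= add1n -[(n - k)%N](subnSK (ltn_ord k)).
by rewrite add0n [y ^+ _.+1]exprSr mulrA.
Qed.

Lemma qbin_absorb (F : fieldType) (q : F) n k :
  (forall m, qpoch q q m != 0) ->
  qbin q n.+1 k.+1 * qpoch q q k.+1 =
  (1 - q ^+ n.+1) * (qbin q n k * qpoch q q k).
Proof.
move=> q0; have [nk|kn] := ltnP n k; first by rewrite !qbin_small // !mul0r mulr0.
have := @qbin_fact _ q n.+1 k.+1 kn; rewrite subSS => E.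
apply: (mulIf (q0 (n - k)%N)); rewrite E -mulrA qbin_fact //.
by rewrite qpochS -exprS mulrC.
Qed.

(** Induction on [k]: the Pascal rule for [qbin p k.+1 j] splits the sum into the cases [(k, l, c)]
    and, after absorption, [(k, l-1, c p)]. *)
Lemma qvandermonde (F : fieldType) (p c : F) k l :
  (forall m, qpoch p p m != 0) ->
  \sum_(j < k.+1) qbin p k j * qbin p l j * qpoch p p j
     * p ^+ (j * j.-1) * c ^+ j * qpoch (c * p ^+ j) p (l - j) =
  qpoch (c * p ^+ k) p l.
Proof.
move=> p0; elim: k l c => [|k IH] l c.
  by rewrite big_ord1 !qbin0 qpoch0 muln0 !expr0 subn0 !mulr1 !mul1r.
(* The matching splitting of the right-hand side; for [l = 0] the factor [1 - p^l] kills the term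
   with the truncated [l.-1]. *)
have -> : qpoch (c * p ^+ k.+1) p l =
    qpoch (c * p ^+ k) p l + c * p ^+ k * (1 - p ^+ l) * qpoch (c * p ^+ k.+1) p l.-1.
  rewrite exprSr [c * _]mulrA; set d := c * p ^+ k.
  case: l => [|l] /=; first by rewrite !qpoch0 expr0; ring.
  by rewrite qpochS qpoch_recl exprS; ring.
rewrite -(IH l c) big_ord_recl.
under eq_bigr => j _ do rewrite /= /bump /= add1n 5!mulrDl.
rewrite big_split /= addrA; congr (_ + _).
  rewrite [RHS]big_ord_recl !qbin0; congr (_ + _).
  by rewrite big_ord_recr /= qbin_small // !mul0r addr0; apply: eq_bigr.
case: l => [|l] /=.
  by rewrite expr0 subrr mulr0 mul0r big1 // => j _; rewrite mulr0 !mul0r.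
have -> : c * p ^+ k.+1 = c * p * p ^+ k by rewrite exprS mulrA.
rewrite -(IH l (c * p)) mulr_sumr; apply: eq_bigr => -[j /= jk] _.
have E := qbin_absorb l j p0; rewrite /= in E.
rewrite add0n subSS; move: E; set b := _ + _ * qbin p l j => E.
have -> : c * p ^+ j.+1 = c * p * p ^+ j by rewrite exprS mulrA.
transitivity (p ^+ (k - j) * qbin p k j * (b * qpoch p p j.+1)
    * p ^+ (j.+1 * j) * c ^+ j.+1 * qpoch (c * p * p ^+ j) p (l - j)).
  by ring.
rewrite E exprMn [c ^+ _]exprS.
have -> : (j.+1 * j = j * j.-1 + j + j)%N by case: (j) => //= i; lia.
have -> : p ^+ k = p ^+ (k - j) * p ^+ j by rewrite -exprD subnK.
by rewrite !exprD; ring.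
Qed.

Lemma qbinE (F : fieldType) (q : F) n k : (forall m, qpoch q q m != 0) ->
  (k <= n)%N -> qbin q n k = qpoch q q n / (qpoch q q k * qpoch q q (n - k)).
Proof.
by move=> q0 kn; rewrite -(qbin_fact q kn) -mulrA mulfK ?mulf_neq0.
Qed.

Lemma qpoch_shift (F : fieldType) (p : F) j r : (forall m, qpoch p p m != 0) ->
  qpoch (p ^+ j) p r = qbin p (r + j).-1 r * qpoch p p r.
Proof.
(* For [j = 0] both sides are 1 if [r = 0], and 0 otherwise. *)
move=> p0; case: j => [|j].
  case: r => [|r]; first by rewrite !qpoch0 qbin0 mul1r.
  by rewrite addn0 qbin_small // mul0r qpoch_recl expr0 subrr mul0r.
apply: (mulfI (p0 j)); rewrite exprS -qpoch_add addnS [(j + r)%N]addnC.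
by rewrite -(qbin_fact p (leq_addr j r)) addKn mulrC.
Qed.

(** Read from right to left, it trades reciprocals depending on [k] for the factors [1 / (c;p)_j],
    free of [k], and Gaussian binomials. *)
Lemma qvandermonde_quot (F : fieldType) (p c : F) n k :
  (forall m, qpoch p p m != 0) -> (forall m, qpoch c p m != 0) -> (k <= n)%N ->
  \sum_(j < n.+1) p ^+ (j * j.-1) * c ^+ j * qpoch p p j / qpoch c p j
     * (qbin p n k * qbin p k j * qbin p (n - k) j) =
  qpoch p p n * qpoch c p n /
    (qpoch p p k * qpoch c p k * (qpoch p p (n - k) * qpoch c p (n - k))).
Proof.
move=> p0 c0 kn.
have := qvandermonde c k (n - k) p0.
rewrite (big_ord_widen n.+1 (fun j => qbin p k j * qbin p (n - k) j * qpoch p p j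
  * p ^+ (j * j.-1) * c ^+ j * qpoch (c * p ^+ j) p (n - k - j)%N)) ?ltnS //.
rewrite big_mkcond /= => vdm.
have -> : qpoch c p n = qpoch c p k * qpoch (c * p ^+ k) p (n - k).
  by rewrite -qpoch_add subnKC.
rewrite -vdm (qbinE p0 kn) !mulr_sumr mulr_suml; apply: eq_bigr => j _.
case: ltnP => [_|kj]; last first.
  by rewrite (qbin_small _ kj) !(mulr0, mul0r).
have [jl|lj] := leqP j (n - k); last first.
  by rewrite (qbin_small _ lj) !(mulr0, mul0r).
have -> : qpoch c p (n - k) = qpoch c p j * qpoch (c * p ^+ j) p (n - k - j).
  by rewrite -qpoch_add subnKC.
have cj0 : qpoch (c * p ^+ j) p (n - k - j) != 0.
  by have := c0 (n - k)%N; rewrite -{1}(subnKC jl) qpoch_add mulf_eq0 => /norP[].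
by field; rewrite cj0 !p0 !c0.
Qed.

(** Both sides are the q-multinomial coefficient with parts [j], [j], [i], [n-2j-i]. On the right a
    single factor depends on [i], ready for Gauss's theorem. *)
Lemma qbin_multinomial (F : fieldType) (p : F) n i j :
  (forall m, qpoch p p m != 0) -> (j.*2 <= n)%N -> (i <= n - j.*2)%N ->
  qbin p n (i + j) * qbin p (i + j) j * qbin p (n - (i + j)) j =
  qpoch p p n / (qpoch p p j ^+ 2 * qpoch p p (n - j.*2)) * qbin p (n - j.*2) i.
Proof.
move=> p0 jn ir; rewrite !qbinE //; try lia.
have -> : (n - (i + j) - j = n - j.*2 - i)%N by lia.
by rewrite addnK; field; rewrite !p0.
Qed.

Lemma sum_ord_support (V : nmodType) (n j : nat) (f : nat -> V) :
  (j.*2 <= n)%N ->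
  (forall k, (k <= n)%N -> (k < j)%N || (n - j < k)%N -> f k = 0) ->
  \sum_(k < n.+1) f k = \sum_(i < (n - j.*2).+1) f (i + j)%N.
Proof.
move=> jn f0; rewrite -!(big_mkord xpredT).
rewrite (big_cat_nat (n := j)) //=; last by lia.
rewrite big_nat_cond big1 ?add0r; last first.
  by move=> k /andP[/andP[_ kj] _]; apply: f0; lia.
rewrite (big_cat_nat (n := (n - j).+1)) //=; try lia.
rewrite [X in _ + X]big_nat_cond [X in _ + X]big1 ?addr0; last first.
  by move=> k /andP[/andP[jk kn] _]; apply: f0; lia.
rewrite -{1}[j]add0n big_addn big_mkord.
by have -> : ((n - j).+1 - j = (n - j.*2).+1)%N by lia.
Qed.

(** * Rational functions with denominator coprime to every [1 + q^k] *)

(** Modulo a common divisor, [X^i = 1] and [X^k = -1], so [X^(ik)] is both [1] and [(-1)^i = -1];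
    the divisor divides 2, a unit over the rationals. *)
Lemma coprimep_Xodd (i k : nat) : odd i ->
  coprimep (1 - 'X^i : {poly rat}) (1 + 'X^k).
Proof.
move=> oi; apply/Bezout_eq1_coprimepP.
have uE := subrX1 ('X^i : {poly rat}) k; set u := \sum_(j < k) _ in uE.
have vE := subrX1 (- 'X^k : {poly rat}) i; set v := \sum_(j < i) _ in vE.
rewrite exprNn -signr_odd oi expr1 mulN1r -!exprM mulnC in vE.
rewrite -exprM in uE.
(* The Bezout coefficients are the two geometric-sum cofactors, halved. *)
exists (2%:R^-1 *: u, 2%:R^-1 *: v) => /=.
rewrite -!scalerAl -scalerDr.
have -> : u * (1 - 'X^i) + v * (1 + 'X^k) =
    - (('X^i - 1) * u) - (- 'X^k - 1) * v by ring.
rewrite -uE -vE.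
have -> : - ('X^(i * k) - 1) - (- 'X^(i * k) - 1) = 2%:R%:P :> {poly rat}.
  by rewrite polyCMn polyC1; ring.
by rewrite -mul_polyC -polyCM mulVf.
Qed.

Lemma qpoch_sq_neq0 (F : fieldType) (q : F) n : (forall m, qpoch q q m != 0) ->
  qpoch (q ^+ 2) (q ^+ 2) n != 0.
Proof.
move=> q0; have := q0 n.*2.
by rewrite qpoch_double -expr2 mulf_eq0 => /norP[_].
Qed.

Lemma qpoch_odd_neq0 (F : fieldType) (q : F) n : (forall m, qpoch q q m != 0) ->
  qpoch q (q ^+ 2) n != 0.
Proof.
move=> q0; have := q0 n.*2.
by rewrite qpoch_double mulf_eq0 => /norP[h _].
Qed.

Lemma qpoch_odd3_neq0 (F : fieldType) (q : F) n : (forall m, qpoch q q m != 0) ->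
  qpoch (q ^+ 3) (q ^+ 2) n != 0.
Proof.
move=> q0; have := qpoch_odd_neq0 n.+1 q0.
by rewrite qpoch_recl -exprS mulf_eq0 => /norP[_].
Qed.

Lemma subr1_neq0 (F : fieldType) (q : F) : (forall m, qpoch q q m != 0) ->
  1 - q != 0.
Proof. by move=> /(_ 1%N); rewrite qpochS qpoch0 mul1r expr0 mulr1. Qed.

(* Equivalently, no cyclotomic polynomial of even index divides [D]. *)
Definition admissible (D : Zq) : Prop :=
  forall k, coprimep (map_poly intr D : {poly rat}) (1 + 'X^k).

(** The localization of [Zq] at the admissible polynomials. Nonzero integers are admissible,
    coprimality being taken over the rationals. *)
Definition even_integral (f : Qq) : Prop :=
  exists D a : Zq, admissible D /\ f * FracField.tofrac D = FracField.tofrac a.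

Lemma even_integral_tofrac (a : Zq) : even_integral (FracField.tofrac a).
Proof.
exists 1, a; split; last by rewrite tofrac1 mulr1.
by move=> k; rewrite rmorph1 coprime1p.
Qed.

Lemma admissibleM (D E : Zq) : admissible D -> admissible E -> admissible (D * E).
Proof. by move=> hD hE k; rewrite rmorphM coprimepMl hD hE. Qed.

Lemma even_integralM f g :
  even_integral f -> even_integral g -> even_integral (f * g).
Proof.
move=> [D [a [hD fD]]] [E [b [hE gE]]]; exists (D * E), (a * b).
by split; [exact: admissibleM | rewrite !tofracM mulrACA fD gE].
Qed.

Lemma even_integralD f g :
  even_integral f -> even_integral g -> even_integral (f + g).
Proof.
move=> [D [a [hD fD]]] [E [b [hE gE]]]; exists (D * E), (a * E + b * D).
split; first exact: admissibleM.
by rewrite tofracD !tofracM -fD -gE; ring.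
Qed.

Lemma even_integralN f : even_integral f -> even_integral (- f).
Proof.
move=> [D [a [hD fD]]]; exists D, (- a).
by rewrite tofracN -fD mulNr.
Qed.

Lemma even_integralB f g :
  even_integral f -> even_integral g -> even_integral (f - g).
Proof. by move=> hf hg; apply: even_integralD => //; apply: even_integralN. Qed.

Lemma even_integral1 : even_integral 1.
Proof. by rewrite -tofrac1; apply: even_integral_tofrac. Qed.

Lemma even_integral0 : even_integral 0.
Proof. by rewrite -tofrac0; apply: even_integral_tofrac. Qed.

Lemma even_integral_qvar : even_integral qvar.
Proof. exact: even_integral_tofrac. Qed.

Lemma even_integralX f n : even_integral f -> even_integral (f ^+ n).
Proof.
move=> hf; elim: n => [|n IH]; first by rewrite expr0; apply: even_integral1.
by rewrite exprS; apply: even_integralM.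
Qed.

Lemma even_integral_sum (I : Type) (r : seq I) (P : pred I) (f : I -> Qq) :
  (forall i, P i -> even_integral (f i)) ->
  even_integral (\sum_(i <- r | P i) f i).
Proof.
move=> hf; apply: (big_ind even_integral) => //; first exact: even_integral0.
exact: even_integralD.
Qed.

Lemma even_integral_qpoch a q n :
  even_integral a -> even_integral q -> even_integral (qpoch a q n).
Proof.
move=> ha hq; apply: (big_ind even_integral); first exact: even_integral1.
  exact: even_integralM.
move=> k _; apply: even_integralB; first exact: even_integral1.
by apply: even_integralM => //; apply: even_integralX.
Qed.

Lemma even_integral_qbin q n k : even_integral q -> even_integral (qbin q n k).
Proof.
move=> hq; elim: n k => [|n IH] [|k] /=;
  try exact: even_integral1; try exact: even_integral0.
apply: even_integralD => //; apply: even_integralM => //.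
exact: even_integralX.
Qed.

Lemma even_integral_inv_odd i : odd i -> even_integral (1 - qvar ^+ i)^-1.
Proof.
move=> oi; exists (1 - 'X^i), 1; split.
  by move=> k; rewrite rmorphB rmorph1 rmorphXn /= map_polyX coprimep_Xodd.
have E : FracField.tofrac (1 - 'X^i : Zq) = 1 - qvar ^+ i.
  by rewrite tofracB tofrac1 tofracXn.
rewrite E tofrac1 mulVf // -E tofrac_eq0 subr_eq0; apply/eqP.
move/(congr1 (fun p : Zq => size p)); rewrite size_poly1 size_polyXn => -[i0].
by rewrite -i0 in oi.
Qed.

Lemma even_integral_inv_qpoch i n : odd i ->
  even_integral (qpoch (qvar ^+ i) (qvar ^+ 2) n)^-1.
Proof.
move=> oi; elim: n => [|n IH].
  by rewrite qpoch0 invr1; apply: even_integral1.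
rewrite qpochS invfM; apply: even_integralM => //.
rewrite -exprM -exprD; apply: even_integral_inv_odd.
by rewrite oddD oi oddM.
Qed.

(** Clearing denominators gives [P D = a Q (-q;q)_n], and [D] is coprime to [(-q;q)_n] over the
    rationals. *)
Lemma divides_numerator (C : Qq) (n : nat) (P : Zq) :
  even_integral (C / qpoch (- qvar) qvar n) -> is_numerator P C ->
  divides (qpoch (- 'X) 'X n) P.
Proof.
move=> [D [a [hD CD]]] [Q [Q0 _ CE]].
have E : FracField.tofrac (qpoch (- 'X : Zq) 'X n) = qpoch (- qvar) qvar n.
  rewrite /qpoch rmorph_prod; apply: eq_bigr => k _.
  by rewrite rmorphB rmorph1 rmorphM rmorphN rmorphXn.
have mon : qpoch (- 'X : Zq) 'X n \is monic.
  rewrite qpochNXE big_add1; apply: monic_prod => k _.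
  by rewrite addrC -[1]opprK -polyC1 -polyCN monicXnsubC.
have fQ0 : FracField.tofrac Q != 0 by rewrite tofrac_eq0.
have n0 : qpoch (- qvar) qvar n != 0 by rewrite -E tofrac_eq0 monic_neq0.
have PD : P * D = a * Q * qpoch (- 'X : Zq) 'X n.
  apply/eqP; rewrite -tofrac_eq !tofracM E -CD CE.
  have cancel (F : fieldType) (x d y z : F) : y != 0 -> z != 0 ->
    x * d = x / y / z * d * y * z by move=> y0 z0; field; rewrite y0 z0.
  by apply/eqP; exact: (cancel _ _ _ _ _ fQ0 n0).
have cop : coprimep (map_poly intr (qpoch (- 'X : Zq) 'X n)) (map_poly intr D : {poly rat}).
  rewrite qpochNXE rmorph_prod.
  apply: (big_ind (fun R : {poly rat} => coprimep R (map_poly intr D))).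
  - exact: coprime1p.
  - by move=> R S hR hS; rewrite coprimepMl hR hS.
  by move=> k _; rewrite rmorphD rmorph1 rmorphXn /= map_polyX coprimep_sym.
have : qpoch (- 'X : Zq) 'X n %| P.
  rewrite -dvdp_rat_int -(Gauss_dvdpl _ cop) -rmorphM PD rmorphM.
  exact: dvdp_mull.
(* The factor obtained is the primitive part of [(-q;q)_n], which is [(-q;q)_n] itself by
   monicity. *)
case/dvdpP_int => r Pr; exists r; rewrite mulrC Pr; congr (_ * _).
have := zpolyEprim (qpoch (- 'X : Zq) 'X n).
by rewrite zcontents_monic // scale1r.
Qed.

(** * The product of the denominator with [G] *)

(** The Pascal rule dual to the defining one; its power of [q] does not involve [n], as
    [sum_qbin_odd] requires. *)
Lemma qbin_pascal (F : fieldType) (q : F) n k : (forall m, qpoch q q m != 0) ->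
  qbin q n.+1 k.+1 = qbin q n k + q ^+ k.+1 * qbin q n k.+1.
Proof.
move=> q0; have [nk|kn] := ltnP n k.
  by rewrite !qbin_small ?(leq_trans nk) // ?mulr0 ?addr0 // ltnW.
apply: (mulIf (q0 k.+1)); have E := qbin_absorb n k q0.
have := E; rewrite [qbin q n.+1 _]/= mulrDl => /(canRL (addrK _)) E'.
rewrite mulrDl -[q ^+ k.+1 * _ * _]mulrA E' qpochS -!exprS.
have -> : q ^+ n.+1 = q ^+ (n - k) * q ^+ k.+1 by rewrite -exprD addnS subnK.
ring.
Qed.

Lemma sum_ord_double (V : nmodType) n (f : nat -> V) :
  \sum_(i < n.*2) f i = \sum_(k < n) (f k.*2 + f k.*2.+1).
Proof.
elim: n => [|n IH]; first by rewrite !big_ord0.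
by rewrite doubleS !big_ord_recr /= IH addrA.
Qed.

(** The dual Pascal rule splits the [k]-th term into the terms of index [2k] and [2k+1] in Gauss's
    expansion of [(-q;q)_(2n)]. *)
Lemma sum_qbin_odd (F : fieldType) (q : F) n : (forall m, qpoch q q m != 0) ->
  \sum_(k < n.+1) qbin q n.*2.+1 k.*2.+1 * q ^+ (k * (2 * k + 1)) =
  qpoch (- q) q n.*2.
Proof.
move=> q0.
have -> : qpoch (- q) q n.*2 =
    \sum_(k < n.*2.+1) qbin q n.*2 k * q ^+ 'C(k, 2) * q ^+ k.
  under eq_bigr => k _ do rewrite -[_ * q ^+ k]mulr1 -(expr1n _ (n.*2 - k)).
  rewrite gauss_qbin /qpoch; apply: eq_bigr => k _.
  by rewrite mulNr opprK mulrC.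
(* A zero term of index [2n+1] is added so that the terms pair up. *)
have -> : \sum_(k < n.*2.+1) qbin q n.*2 k * q ^+ 'C(k, 2) * q ^+ k =
    \sum_(k < n.+1.*2) qbin q n.*2 k * q ^+ 'C(k, 2) * q ^+ k.
  by rewrite doubleS [RHS]big_ord_recr /= (qbin_small _ (ltnSn _)) !mul0r addr0.
rewrite (sum_ord_double n.+1 (fun k => qbin q n.*2 k * q ^+ 'C(k, 2) * q ^+ k)).
apply: eq_bigr => -[k /= _] _.
rewrite -/(qbin q n.*2.+1 k.*2.+1) qbin_pascal // mulrDl.
have E : (k * (2 * k + 1) = 'C(k.*2, 2) + k.*2)%N.
  by elim: (k) => // i; rewrite doubleS !binS !bin1 !bin0; nia.
congr (_ + _); first by rewrite E exprD mulrA.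
rewrite binS bin1 -E; ring.
Qed.

Lemma carlitz_den_conv (F : fieldType) (q : F) n : (forall m, qpoch q q m != 0) ->
  \sum_(k < n.+1) (-1) ^+ k * q ^+ (k * (2 * k + 1)) / qpoch q q k.*2.+1
    * ((-1) ^+ (n - k) / qpoch q q (n - k).*2) =
  (-1) ^+ n * qpoch (- q) q n.*2 / qpoch q q n.*2.+1.
Proof.
move=> q0; rewrite -sum_qbin_odd // mulr_sumr mulr_suml.
apply: eq_bigr => -[k /= kn] _.
have -> : (-1) ^+ n = (-1) ^+ k * (-1) ^+ (n - k) :> F by rewrite -exprD subnKC.
have le : (k.*2.+1 <= n.*2.+1)%N by rewrite ltnS leq_double.
rewrite -/(qbin q n.*2.+1 k.*2.+1) (qbinE q0 le) subSS -doubleB.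
by field; rewrite !q0.
Qed.

(** * The product of the numerator with [G] *)

(** For positive [j], pulling [-p] out of each factor leaves [(p^(j-1);p)_r]. For [j = 0] the factor
    of index 1 is [-p + p], so only [r <= 1] survives. *)
Lemma prod_sub_qpoch (F : fieldType) (p : F) j r :
  (forall m, qpoch p p m != 0) ->
  \prod_(0 <= i < r) (- p + p ^+ i * p ^+ j) =
  (if j is j'.+1 then (- p) ^+ r * qbin p (r + j').-1 r else (r <= 1)%:R)
    * qpoch p p r.
Proof.
move=> p0; case: j => [|j].
  case: r => [|[|r]]; first by rewrite big_geq // qpoch0 mulr1.
    by rewrite big_nat1 qpochS qpoch0 !expr0 -[(1 <= 1)%:R]/1; ring.
  by rewrite big_nat_recl // big_nat_recl // !expr0 expr1 !mulr1 addNr mul0r mulr0 mul0r.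
rewrite -mulrA -qpoch_shift // /qpoch -{2}[r]subn0 -prodr_const_nat -big_split.
by apply: eq_bigr => i _ /=; rewrite exprS; ring.
Qed.

Lemma mulnn_pred i : (i * i.-1 = 'C(i, 2) * 2)%N.
Proof. by elim: i => // i IH; rewrite binS bin1 mulnDl -IH; case: (i) => //= k; lia. Qed.

Lemma mulnn_predD i j :
  ((i + j) * (i + j).-1 = j * j.-1 + 2 * (i * j) + 'C(i, 2) * 2)%N.
Proof.
by rewrite -mulnn_pred; case: i j => [|i] [|j] //=; rewrite ?addn0 /=; lia.
Qed.

(** The sum over [k] left inside by the q-Vandermonde expansion in base [q^2]. Its last factor comes
    from [1 / (q;q)_(2m) = (1 - q^(2m+1)) / (q;q)_(2m+1)] with [m = n - k]. *)
Definition carlitz_inner (F : fieldType) (q : F) n j : F :=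
  \sum_(k < n.+1) qbin (q ^+ 2) n k * qbin (q ^+ 2) k j * qbin (q ^+ 2) (n - k) j
    * ((-1) ^+ (n - k) * q ^+ (k * k.-1) * (1 - q ^+ (n - k).*2.+1)).

Lemma carlitz_inner_small (F : fieldType) (q : F) n j : (n < j.*2)%N ->
  carlitz_inner q n j = 0.
Proof.
move=> nj; apply: big1 => -[k /= kn] _.
have [kj|jk] := ltnP k j; first by rewrite (qbin_small _ kj) mulr0 !mul0r.
by rewrite (@qbin_small _ _ (n - k)) ?mulr0 ?mul0r //; lia.
Qed.

(** Put [k = i + j]. The two terms of [1 - q^(2(n-k)+1)] give two sums over [i], evaluated by
    Gauss's theorem in base [p] at [x = p^j] with [y = -1] and [y = -p]. Both are multiples of
    [(p;p)_r], which cancels. *)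
Lemma carlitz_innerE (F : fieldType) (q : F) n j (p := q ^+ 2)
    (r := (n - j.*2)%N) :
  (forall m, qpoch q q m != 0) -> (j.*2 <= n)%N ->
  carlitz_inner q n j = qpoch p p n / qpoch p p j ^+ 2 * (-1) ^+ j * q ^+ (j * j.-1)
   * ((-1) ^+ r * qbin p (r + j).-1 r - q ^+ j.*2.+1 *
      (if j is j'.+1 then (- p) ^+ r * qbin p (r + j').-1 r else (r <= 1)%:R)).
Proof.
move=> q0 jn; have p0 m : qpoch p p m != 0 by apply: qpoch_sq_neq0.
rewrite /carlitz_inner.
pose f k := qbin p n k * qbin p k j * qbin p (n - k) j
    * ((-1) ^+ (n - k) * q ^+ (k * k.-1) * (1 - q ^+ (n - k).*2.+1)).
have f0 k : (k <= n)%N -> (k < j)%N || (n - j < k)%N -> f k = 0.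
  rewrite /f; case: ltnP => [kj _ _|jk kn /= kj].
    by rewrite (qbin_small _ kj) mulr0 !mul0r.
  by rewrite (@qbin_small _ _ (n - k)) ?mulr0 ?mul0r //; lia.
rewrite -[LHS]/(\sum_(k < n.+1) f k) (sum_ord_support jn f0) -/r.
have G1 := gauss_qbin p (p ^+ j) (-1) r.
have G2 := gauss_qbin p (p ^+ j) (- p) r.
rewrite prod_sub_qpoch // in G2.
have E1 : \prod_(0 <= i < r) (-1 + p ^+ i * p ^+ j) =
    (-1) ^+ r * qbin p (r + j).-1 r * qpoch p p r.
  rewrite -mulrA -qpoch_shift // /qpoch -{2}[r]subn0 -prodr_const_nat -big_split.
  by apply: eq_bigr => i _ /=; ring.
rewrite E1 in G1.
set w1 := (-1) ^+ r * _ in G1 *; set w2 := (if j is _.+1 then _ else _) in G2 *.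
transitivity (qpoch p p n / (qpoch p p j ^+ 2 * qpoch p p r) * (-1) ^+ j *
   q ^+ (j * j.-1) * (w1 * qpoch p p r - q ^+ j.*2.+1 * (w2 * qpoch p p r)));
  last by field; rewrite !p0.
rewrite -G1 -G2 mulrBr mulr_sumr [in RHS]mulr_sumr mulr_sumr -sumrB.
apply: eq_bigr => -[i /= ir] _; rewrite /f qbin_multinomial //.
have -> : (n - (i + j) = (r - i) + j)%N by rewrite /r; lia.
have -> : q ^+ ((i + j) * (i + j).-1) = q ^+ (j * j.-1) * p ^+ j ^+ i * p ^+ 'C(i, 2).
  by rewrite mulnn_predD /p -!exprM -!exprD; congr (_ ^+ _); lia.
have -> : q ^+ (r - i + j).*2.+1 = q ^+ j.*2.+1 * p ^+ (r - i).
  by rewrite /p -!exprM -!exprD; congr (_ ^+ _); lia.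
by rewrite [(- p) ^+ _]exprNn exprD -/r; ring.
Qed.

(** Raising [2(n-k)] to [2(n-k)+1] lets both Pochhammer products factor as [(q;q)_(2m+1) = (1-q)
    (q^3;q^2)_m (q^2;q^2)_m], so [qvandermonde_quot] applies with [c = q^3]. *)
Lemma carlitz_num_conv (F : fieldType) (q : F) n (p := q ^+ 2) :
  (forall m, qpoch q q m != 0) ->
  \sum_(k < n.+1) q ^+ (k * k.-1) / qpoch q q k.*2.+1
    * ((-1) ^+ (n - k) / qpoch q q (n - k).*2) =
  ((1 - q) ^+ 2 * qpoch (q ^+ 3) p n * qpoch p p n)^-1 *
  \sum_(j < n.+1) p ^+ (j * j.-1) * (q ^+ 3) ^+ j * qpoch p p j / qpoch (q ^+ 3) p j
     * carlitz_inner q n j.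
Proof.
move=> q0; have p0 m : qpoch p p m != 0 by apply: qpoch_sq_neq0.
have c0 m : qpoch (q ^+ 3) p m != 0 by apply: qpoch_odd3_neq0.
have q1 := subr1_neq0 q0.
have qodd k : qpoch q q k.*2.+1 = (1 - q) * qpoch (q ^+ 3) p k * qpoch p p k.
  rewrite qpochS qpoch_double -expr2 -/p mulrAC; congr (_ * _).
  by rewrite -exprS -mul2n exprS exprM -/p -qpochS qpoch_recl -exprS.
transitivity (\sum_(k < n.+1) ((1 - q) ^+ 2 * qpoch (q ^+ 3) p n * qpoch p p n)^-1 *
   ((qpoch p p n * qpoch (q ^+ 3) p n / (qpoch p p k * qpoch (q ^+ 3) p k *
    (qpoch p p (n - k) * qpoch (q ^+ 3) p (n - k)))) *
    ((-1) ^+ (n - k) * q ^+ (k * k.-1) * (1 - q ^+ (n - k).*2.+1)))).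
  apply: eq_bigr => k _.
  have := qodd (n - k)%N; have := q0 (n - k).*2.+1.
  rewrite [in X in _ -> X -> _]qpochS -exprS qpochS -exprS mulf_eq0 => /norP[h1 h2].
  move/(canRL (mulfK h2)) => ->.
  by rewrite qodd; field; rewrite q1 h2 !p0 !c0.
rewrite -mulr_sumr; congr (_ * _).
under eq_bigr => k _.
  rewrite -(qvandermonde_quot p0 c0) -1?ltnS // mulr_suml. over.
rewrite exchange_big /=; apply: eq_bigr => j _; rewrite mulr_sumr.
by apply: eq_bigr => k _; rewrite [RHS]mulrA.
Qed.

Lemma qpoch_ratio (F : fieldType) (q : F) n j (p := q ^+ 2) : (j.*2 <= n)%N ->
  qpoch q q n = qpoch p p j * (qpoch q p j * qpoch (q * q ^+ j.*2) q (n - j.*2)).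
Proof.
move=> jn; rewrite -{1}(subnKC jn) qpoch_add qpoch_double -expr2.
by rewrite mulrA [qpoch p p j * _]mulrC.
Qed.

(** Of [(p;p)_j^2] in the denominator, one factor cancels against the q-Vandermonde term and the
    other against [(q;q)_n]. Only reciprocals of factors [1 - q^i] with [i] odd remain. *)
Lemma carlitz_num_conv_scaled (F : fieldType) (q : F) n (p := q ^+ 2) :
  (forall m, qpoch q q m != 0) ->
  (\sum_(k < n.+1) q ^+ (k * k.-1) / qpoch q q k.*2.+1
    * ((-1) ^+ (n - k) / qpoch q q (n - k).*2)) * qpoch q q n =
  \sum_(j < n.+1 | (j.*2 <= n)%N) (1 - q)^-1 ^+ 2
    * (qpoch (q ^+ 3) p n)^-1 * (qpoch (q ^+ 3) p j)^-1
    * (p ^+ (j * j.-1) * (q ^+ 3) ^+ j * (-1) ^+ j * q ^+ (j * j.-1)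
       * (qpoch q p j * qpoch (q * q ^+ j.*2) q (n - j.*2))
       * ((-1) ^+ (n - j.*2) * qbin p (n - j.*2 + j).-1 (n - j.*2) -
          q ^+ j.*2.+1 * (if (j : nat) is j'.+1
             then (- p) ^+ (n - j.*2) * qbin p (n - j.*2 + j').-1 (n - j.*2)
             else (n - j.*2 <= 1)%:R))).
Proof.
move=> q0; rewrite carlitz_num_conv // mulrAC mulr_sumr [RHS]big_mkcond.
have p0 m : qpoch p p m != 0 by apply: qpoch_sq_neq0.
have c0 m : qpoch (q ^+ 3) p m != 0 by apply: qpoch_odd3_neq0.
have q1 := subr1_neq0 q0.
apply: eq_bigr => -[j /= _] _; case: leqP => [jn|nj]; last first.
  by rewrite carlitz_inner_small // !mulr0.
rewrite (carlitz_innerE q0 jn) (qpoch_ratio q jn) -/p.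
move: (_ - _ * (if _ is _.+1 then _ else _)) => w.
move: (qpoch (q * _) q _) => v.
by field; rewrite q1 !p0 !c0.
Qed.

Lemma even_integral_sign n : even_integral ((-1) ^+ n).
Proof. by apply: even_integralX; apply: even_integralN; apply: even_integral1. Qed.

Lemma even_integral_carlitz_num n :
  even_integral ((\sum_(k < n.+1) qvar ^+ (k * k.-1) / qpoch qvar qvar k.*2.+1
    * ((-1) ^+ (n - k) / qpoch qvar qvar (n - k).*2)) * qpoch qvar qvar n).
Proof.
rewrite (carlitz_num_conv_scaled n qpoch_qvar_neq0).
have iq := even_integral_qvar.
have iX k : even_integral (qvar ^+ k) := even_integralX k iq.
have ip := iX 2.
have ib m k : even_integral (qbin (qvar ^+ 2) m k) := even_integral_qbin m k ip.
apply: even_integral_sum => -[j /= _] _.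
apply: even_integralM.
  apply: even_integralM; last exact: even_integral_inv_qpoch.
  apply: even_integralM; last exact: even_integral_inv_qpoch.
  by apply: even_integralX; have := @even_integral_inv_odd 1 isT; rewrite expr1.
apply: even_integralM; last first.
  apply: even_integralB.
    by apply: even_integralM; [exact: even_integral_sign | exact: ib].
  apply: even_integralM; first exact: iX.
  case: j => [|j].
    by case: (_ <= _)%N; [exact: even_integral1 | exact: even_integral0].
  apply: even_integralM; last exact: ib.
  by apply: even_integralX; apply: even_integralN.
apply: even_integralM; last first.
  apply: even_integralM; apply: even_integral_qpoch => //.
  by apply: even_integralM; [exact: iq | exact: iX].
apply: even_integralM; last exact: iX.
apply: even_integralM; last exact: even_integral_sign.
by apply: even_integralM; apply: even_integralX; exact: iX.
Qed.

(** * Even-integrality of the product of the denominator with [G] *)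

(** Uses [(q;q)_(2n+1) = (q;q^2)_(n+1) (q;q)_n (-q;q)_n]; the factor [(-q;q)_n] cancels against the
    first half of [(-q;q)_(2n)]. *)
Lemma carlitz_den_conv_scaled (F : fieldType) (q : F) n :
  (forall m, qpoch q q m != 0) ->
  (\sum_(k < n.+1) (-1) ^+ k * q ^+ (k * (2 * k + 1)) / qpoch q q k.*2.+1
    * ((-1) ^+ (n - k) / qpoch q q (n - k).*2)) * qpoch q q n =
  (-1) ^+ n * qpoch (- q * q ^+ n) q n * (qpoch (q ^+ 1) (q ^+ 2) n.+1)^-1.
Proof.
move=> q0; rewrite carlitz_den_conv // -[in qpoch (- q) q _]addnn qpoch_add.
have p0 := qpoch_sq_neq0 n q0; have o0 := qpoch_odd_neq0 n.+1 q0.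
have -> : qpoch q q n.*2.+1 = qpoch q (q ^+ 2) n.+1 * qpoch (q ^+ 2) (q ^+ 2) n.
  rewrite 2!qpochS qpoch_double -expr2 -mul2n exprM.
  by rewrite mulrAC.
move: p0; rewrite qpoch_square mulf_eq0 => /norP[a0 b0].
by rewrite expr1; field; rewrite a0 b0 o0.
Qed.

Lemma even_integral_carlitz_den n :
  even_integral ((\sum_(k < n.+1) (-1) ^+ k * qvar ^+ (k * (2 * k + 1))
      / qpoch qvar qvar k.*2.+1
    * ((-1) ^+ (n - k) / qpoch qvar qvar (n - k).*2)) * qpoch qvar qvar n).
Proof.
rewrite (carlitz_den_conv_scaled n qpoch_qvar_neq0).
have iq := even_integral_qvar.
apply: even_integralM; last exact: even_integral_inv_qpoch.
apply: even_integralM; first exact: even_integral_sign.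
apply: even_integral_qpoch => //; apply: even_integralM.
  exact: even_integralN.
exact: even_integralX.
Qed.

(** * Power series division and the conclusion *)

(** Coefficients up to [n] depend only on truncations, so associativity is inherited from
    polynomials. *)
Lemma fps_mulA (R : nzRingType) (f g h : nat -> R) :
  fps_mul (fps_mul f g) h =1 fps_mul f (fps_mul g h).
Proof.
move=> n; pose P (u : nat -> R) := \poly_(i < n.+1) u i.
have PM u v m : (m <= n)%N -> (P u * P v)`_m = fps_mul u v m.
  move=> mn; rewrite coefM; apply: eq_bigr => -[i /= im] _.
  by rewrite !coef_poly !ltnS (leq_trans _ mn) ?(leq_trans (leq_subr _ _) mn).
rewrite -!PM // !(coefM (P _)).
transitivity ((P f * P g * P h)`_n).
  rewrite coefM; apply: eq_bigr => -[i /= im] _; congr (_ * _).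
  by rewrite PM // coef_poly im.
rewrite -mulrA coefM; apply: eq_bigr => -[i /= im] _; congr (_ * _).
by rewrite PM ?leq_subr // coef_poly ltnS leq_subr.
Qed.

(** Strong induction: scaled by [(q;q)_n], the recurrence for [f n] has Gaussian binomials as
    coefficients and divides only by [g 0]. *)
Lemma even_integral_fps_quot (f g h : nat -> Qq) (q := qvar) :
  (forall n, even_integral (g n * qpoch q q n)) ->
  (forall n, even_integral (h n * qpoch q q n)) ->
  g 0%N != 0 -> even_integral (g 0%N)^-1 -> fps_mul f g =1 h ->
  forall n, even_integral (f n * qpoch q q n).
Proof.
move=> ig ih g0 ig0 fg; elim/ltn_ind => n IH.
have split : f n * qpoch q q n = (g 0%N)^-1 * (h n * qpoch q q n
    - \sum_(i < n) qbin q n i * (f i * qpoch q q i)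
       * (g (n - i)%N * qpoch q q (n - i))).
  apply: (mulfI g0); rewrite (mulVKf g0) -fg /fps_mul big_ord_recr /= subnn.
  rewrite mulrDl mulr_suml.
  rewrite (eq_bigr (fun i : 'I_n => qbin q n i * (f i * qpoch q q i)
      * (g (n - i)%N * qpoch q q (n - i)))); last first.
    have shuffle (F : fieldType) (x y b u v : F) :
      x * y * (b * u * v) = b * (x * u) * (y * v) by ring.
    by move=> -[i /= /ltnW im] _; rewrite -(qbin_fact q im) shuffle.
  by rewrite addrC addKr mulrA [g _ * _]mulrC.
rewrite split; apply: even_integralM => //.
apply: even_integralB; first exact: ih.
apply: even_integral_sum => -[i /= im] _.
apply: even_integralM; last exact: ig.
apply: even_integralM; last exact: IH.
by apply: even_integral_qbin; exact: even_integral_qvar.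
Qed.

Lemma fps_mul_odd (R : nzRingType) (f g : nat -> R) n :
  (forall k, g k.*2 = 0) ->
  fps_mul f g n.*2.+1 =
  fps_mul (fun k => f k.*2) (fun k => g k.*2.+1) n.
Proof.
move=> g0; rewrite /fps_mul.
rewrite (sum_ord_double n.+1 (fun i => f i * g (n.*2.+1 - i)%N)).
apply: eq_bigr => -[k /= kn] _; rewrite subSS -doubleB g0 mulr0 addr0.
by rewrite subSn ?leq_double // -doubleB.
Qed.

Lemma qpoch_double_ratio (F : fieldType) (q c : F) n :
  (forall m, qpoch q q m != 0) ->
  c / qpoch (- q) q n = c / qpoch q q n.*2 * qpoch q q n * qpoch q (q ^+ 2) n.
Proof.
move=> q0; have p0 := qpoch_sq_neq0 n q0; have o0 := qpoch_odd_neq0 n q0.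
move: p0; rewrite qpoch_double -expr2 qpoch_square mulf_eq0 => /norP[a0 b0].
by field; rewrite a0 b0 o0.
Qed.

Theorem theorem1p3 (C : nat -> Qq) (hC : is_qCarlitz C) (n : nat) (P : Zq)
    (hP : is_numerator P (C (2 * n)%N)) :
  divides (qpoch (- 'X) 'X n) P.
Proof.
rewrite mul2n in hP; apply: divides_numerator hP.
(* Up to the polynomial [(q;q^2)_n], the quotient is the coefficient of [x^(2n)] scaled by
   [(q;q)_n]. *)
rewrite (qpoch_double_ratio _ n qpoch_qvar_neq0).
apply: even_integralM; last first.
  apply: even_integral_qpoch; first exact: even_integral_qvar.
  by apply: even_integralX; exact: even_integral_qvar.
(* In powers of [x^2]: the denominator and the numerator, each divided by [x], and [G]. *)
pose s k := (-1) ^+ k * qvar ^+ (k * (2 * k + 1)) / qpoch qvar qvar k.*2.+1.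
pose N k := qvar ^+ (k * k.-1) / qpoch qvar qvar k.*2.+1.
pose g k := (-1) ^+ k / qpoch qvar qvar k.*2.
have sE k : carlitz_den k.*2.+1 = s k.
  by rewrite /carlitz_den /= odd_double uphalf_double.
have NE k : carlitz_num k.*2.+1 = N k.
  by rewrite /carlitz_num /= odd_double uphalf_double subn1.
have cs : fps_mul (fun k => carlitz_gf C k.*2) s =1 N.
  move=> k; rewrite -NE -hC fps_mul_odd; last first.
    by move=> i; rewrite /carlitz_den odd_double.
  by apply: eq_bigr => i _; rewrite sE.
have sg0 : fps_mul s g 0%N = (1 - qvar ^+ 1)^-1.
  rewrite /fps_mul big_ord1 /s /g /= mul0n !expr0 qpochS !qpoch0 expr0 expr1.
  by rewrite invr1 !mulr1 !mul1r.
apply: (@even_integral_fps_quot (fun k => carlitz_gf C k.*2) (fps_mul s g) (fps_mul N g)).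
- exact: even_integral_carlitz_den.
- exact: even_integral_carlitz_num.
- by rewrite sg0 invr_eq0 expr1; apply: subr1_neq0; exact: qpoch_qvar_neq0.
- rewrite sg0 invrK; apply: even_integralB; first exact: even_integral1.
  by apply: even_integralX; exact: even_integral_qvar.
by move=> k; rewrite -fps_mulA; apply: eq_bigr => i _; rewrite cs.
Qed.
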